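(* Let $K_A,K_B$ be key systems of equal finite dimension $|K_A|=|K_B|=d$, let $S_A,S_B$ be finite-dimensional shield systems, and let $K_A',K_B'$ be copies of $K_A,K_B$. Let $V=\mathrm{CNOT}_{K_AK_A'}\otimes\mathrm{CNOT}_{K_BK_B'}$ (unprimed systems are controls, primed systems are targets) and define the map $\mathcal{E}:K_AK_B\to K_A'K_B'K_AK_B$ by $$\mathcal{E}(\varrho_{K_AK_B})=V^\dagger\left(\hat\Phi_{K_A'K_B'}\otimes\varrho_{K_AK_B}\right)V .$$ Then for any key correlated state $\rho$ on $K_AK_BS_AS_B$, $$(\mathcal{E}_{K_AK_B}\otimes\mathrm{id}_{S_AS_B})(\rho)=\frac{1}{|K_B|}\sum_{j=0}^{d-1}\phi_j\otimes\mathcal{Z}^j_{K_B}(\rho),$$ where $\phi_j$ is a state of $K_A'K_B'$ and $\mathcal{Z}^j_{K_B}(\rho)$ is a state of $K_AK_BS_AS_B$.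
   Context: With computational basis $\{|i\rangle\}_{i\in\mathbb{Z}_d}$ and $\omega=e^{2\pi i/d}$: $|\Phi\rangle=\frac{1}{\sqrt d}\sum_i|ii\rangle$, $\Phi=|\Phi\rangle\langle\Phi|$, $\hat\Phi=\frac1d\sum_i|ii\rangle\langle ii|$, $Z=\sum_j\omega^j|j\rangle\langle j|$, and $\mathcal{Z}^j(\varrho)=Z^j\varrho Z^{-j}$ ($\mathcal{Z}^j_{K_B}$ acts on $K_B$ and as the identity elsewhere). $\phi_j=|\phi_j\rangle\langle\phi_j|=\mathcal{Z}^j_{K_B}(\Phi)$ for $j=0,\dots,d-1$, with $|\phi_j\rangle=(\mathbb{1}\otimes Z^j)|\Phi\rangle$. The generalized CNOT on control $\otimes$ target is $\mathrm{CNOT}=\sum_{a,b\in\mathbb{Z}_d}|a,a+b\rangle\langle a,b|$ (addition mod $d$). The maximally correlated subspace of $K_AK_B$ is $\mathrm{span}\{|ii\rangle\}=\mathrm{span}\{|\phi_j\rangle\}$. A state $\rho$ on $K_AK_BS_AS_B$ is key correlated if its key part is supported only on the maximally correlated subspace, i.e. $\rho=\sum_{\mu\nu}|\phi_\mu\rangle\langle\phi_\nu|\otimes P_{\mu\nu}$ for some matrices $P_{\mu\nu}$ on $S_AS_B$. *)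

(* Defs.v *)
From mathcomp Require Import all_boot all_order all_algebra.
From mathcomp Require Import spectral sesquilinear.
From mathcomp Require Import mxtens complex.
From mathcomp Require Import reals trigo.

Set Implicit Arguments.
Unset Strict Implicit.
Unset Printing Implicit Defensive.

Import Order.TTheory GRing.Theory Num.Theory.
Local Open Scope ring_scope.
Local Open Scope complex_scope.
Local Open Scope sesquilinear_scope.

(* A system of dimension p is C^p with computational basis indexed by 'I_p.   *)
(* Composite systems use the Kronecker product [*t], so the basis of C^p (x)  *)
(* C^q is 'I_(p * q), in row-major order through [mxtens_index]. Systems are  *)
(* listed in the order K_A' K_B' K_A K_B S_A S_B (CNOT: control, target).     *)

(* Addition of Z_d, for every d (unlike 'Z_d, which is Z_2 when d <= 1). *)
Lemma ord_addmod_proof d (a b : 'I_d) : ((a + b) %% d < d)%N.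
Proof. by rewrite ltn_mod (leq_trans _ (ltn_ord a)). Qed.
Definition ord_addmod d (a b : 'I_d) : 'I_d := Ordinal (ord_addmod_proof a b).

Section States.
Variable R : realType.
Let C := R[i].

Definition ketbra n (u v : 'cV[C]_n) : 'M[C]_n := u *m v^t*.

Definition is_psd n (A : 'M[C]_n) : Prop :=
  A^t* = A /\ forall v : 'cV[C]_n, 0 <= (v^t* *m A *m v) 0 0.

Definition is_state n (A : 'M[C]_n) : Prop := is_psd A /\ \tr A = 1.

(* f (x) id_r: apply f to each block (1 (x) <k|) rho (1 (x) |l>) of rho. *)
Definition tens_id p q r (f : 'M[C]_p -> 'M[C]_q) (rho : 'M[C]_(p * r)) :
    'M[C]_(q * r) :=
  \sum_(k < r) \sum_(l < r)
    tensmx (f (\matrix_(i < p, j < p)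
                 rho (mxtens_index (i, k)) (mxtens_index (j, l))))
           (delta_mx k l).

(* The row-major index of (i, (j, k)) equals that of ((i, j), k) as a natural *)
(* number, so reassociating a tensor product is a mere cast of dimensions.    *)
Definition reassoc p q r (A : 'M[C]_(p * (q * r))) : 'M[C]_(p * q * r) :=
  castmx (mulnA p q r, mulnA p q r) A.

Section Key.
Variable d : nat.

Definition ket (i : 'I_d) : 'cV[C]_d := delta_mx i 0.

Definition ket2 (i j : 'I_d) : 'cV[C]_(d * d) := tensmx (ket i) (ket j).

Definition omega : C :=
  cos (2 * pi / d%:R : R) +i* sin (2 * pi / d%:R : R).

Definition Zmx : 'M[C]_d := \sum_(j < d) omega ^+ j *: ketbra (ket j) (ket j).

Definition Phi_ket : 'cV[C]_(d * d) := (sqrtC d%:R)^-1 *: \sum_(i < d) ket2 i i.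

Definition Phi : 'M[C]_(d * d) := ketbra Phi_ket Phi_ket.

Definition Phi_hat : 'M[C]_(d * d) :=
  (d%:R)^-1 *: \sum_(i < d) ketbra (ket2 i i) (ket2 i i).

Definition phi_ket (j : nat) : 'cV[C]_(d * d) :=
  tensmx 1%:M (Zmx ^+ j) *m Phi_ket.

Definition Zmap_KB (j : nat) (A : 'M[C]_(d * d)) : 'M[C]_(d * d) :=
  tensmx 1%:M (Zmx ^+ j) *m A *m tensmx 1%:M (invmx (Zmx ^+ j)).

Definition phi (j : nat) : 'M[C]_(d * d) := Zmap_KB j Phi.

Definition CNOT : 'M[C]_(d * d) :=
  \sum_(a < d) \sum_(b < d) ketbra (ket2 a (ord_addmod a b)) (ket2 a b).

(* Basis index of K_A' K_B' K_A K_B to basis index of K_A K_A' K_B K_B'. *)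
Definition pair_keys (x : 'I_(d * d * (d * d))) : 'I_(d * d * (d * d)) :=
  let: (k', k) := mxtens_unindex x in
  let: (a', b') := mxtens_unindex k' in
  let: (a, b) := mxtens_unindex k in
  mxtens_index (mxtens_index (a, a'), mxtens_index (b, b')).

(* CNOT_{K_A K_A'} (x) CNOT_{K_B K_B'}, as an operator of K_A' K_B' K_A K_B. *)
Definition Vmx : 'M[C]_(d * d * (d * d)) :=
  mxsub pair_keys pair_keys (tensmx CNOT CNOT).

Definition Emap (A : 'M[C]_(d * d)) : 'M[C]_(d * d * (d * d)) :=
  Vmx^t* *m tensmx Phi_hat A *m Vmx.

Definition key_correlated s (rho : 'M[C]_(d * d * s)) : Prop :=
  exists P : 'I_d -> 'I_d -> 'M[C]_s,
    rho = \sum_(mu < d) \sum_(nu < d)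
            tensmx (ketbra (phi_ket mu) (phi_ket nu)) (P mu nu).

End Key.
End States.

(* Main.v *)
(* In the computational basis V permutes the basis vectors, so on the dyad     *)
(* |ii><jj| both sides are explicit. The left side is                          *)
(* d^-1 sum_m |m-i,m-i><m-j,m-j| (x) |ii><jj|; on the right side the character *)
(* sum sum_k omega^(k(a+i) - k(b+j)) keeps exactly the terms                   *)
(* |aa><bb| (x) |ii><jj| with a + i = b + j mod d.                             *)
Require Import Defs.
From mathcomp Require Import all_boot all_order all_algebra.
From mathcomp Require Import sesquilinear.
From mathcomp Require Import mxtens complex.
From mathcomp Require Import reals trigo.

Set Implicit Arguments.
Unset Strict Implicit.
Unset Printing Implicit Defensive.

Import Order.TTheory GRing.Theory Num.Theory.
Local Open Scope ring_scope.
Local Open Scope sesquilinear_scope.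

(** Both sides are compared entry by entry. Since V sends (a', b', a, b) to (a + a', b + b', a, b),
    conjugating by it only relabels entries ([EmapE]): an entry of [Emap A] is an entry of [Phi_hat]
    at shifted indices times an entry of A. Conjugating by Z^j multiplies an entry by a phase
    ([Zmap_KBE]), so summing over j yields a character sum ([sum_prim_root_ratio]). Key correlation
    forces a = b and c = e ([key_correlated_supp]). Then a + a' = b + b' reduces to a' = b', the
    support of Phi, and the remaining diagonal condition a + a' = c + c' mod d of [Phi_hat] is the
    one that the character sum selects. [Emap_correlated] proves this for one block; the shield only
    indexes blocks. *)

(** Half-angle formula: cos x = 1 - 2 sin(x/2)^2, and the sine is positive on (0, pi). This
    separates the lower powers of [omega] from 1. *)
Lemma cos_lt1 (R : realType) (x : R) : 0 < x < 2 * pi -> cos x < 1.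
Proof.
move=> /andP[x0 xpi]; have -> : x = (x / 2) *+ 2 by rewrite -mulr_natr divfK ?pnatr_eq0.
rewrite cos_mulr2n cos2sin2 ltrBlDr -mulr2n ltrMn2r /= gtrBl exprn_gt0 //.
by rewrite sin_gt0_pi // divr_gt0 //= ltr_pdivrMr // mulrC.
Qed.

Lemma cis_expr (R : realType) (x : R) (n : nat) :
  ((cos x +i* sin x) ^+ n = cos (n%:R * x) +i* sin (n%:R * x))%C.
Proof.
elim: n => [|n IH]; first by rewrite expr0 mul0r cos0 sin0.
rewrite exprS IH -natr1 mulrDl mul1r [_ * x + x]addrC cosD sinD.
by apply/eqP; rewrite eq_complex /= !eqxx /= addrC.
Qed.

Lemma omega_prim (R : realType) (d : nat) : (0 < d)%N ->
  d.-primitive_root (omega R d).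
Proof.
move=> d0; apply/andP; split=> //; apply/forallP => i.
have dR : 0 < d%:R :> R by rewrite ltr0n.
rewrite unity_rootE /omega cis_expr; apply/eqP.
have [->|ni] := eqVneq i.+1 d.
  rewrite mulrCA divff ?(gt_eqF dR) // mulr1 mulr_natl cos2pi sin2pi.
  exact/eqP.
have lt_id : (i.+1 < d)%N by rewrite ltn_neqAle ni ltn_ord.
(* The real part alone distinguishes this power from 1. *)
rewrite eq_complex /= lt_eqF // cos_lt1 //.
rewrite mulrCA !mulr_gt0 ?pi_gt0 ?invr_gt0 ?ltr0n //=.
by rewrite gtr_pMr ?mulr_gt0 ?pi_gt0 ?ltr0n // ltr_pdivrMr // mul1r ltr_nat.
Qed.

(** Orthogonality of the characters of Z_d. The ratio r satisfies r^d = 1, so (r - 1) times the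
    geometric sum is r^d - 1 = 0; either r = 1 or the sum vanishes. *)
Lemma sum_prim_root_ratio (F : fieldType) (d : nat) (z : F) (m n : nat) :
    d.-primitive_root z ->
  \sum_(j < d) (z ^+ m / z ^+ n) ^+ j = d%:R *+ (m == n %[mod d]).
Proof.
move=> pz; have zn0 : z ^+ n != 0.
  by rewrite expf_neq0 // (prim_root_eq0 pz) -lt0n (prim_order_gt0 pz).
rewrite -(eq_prim_root_expr pz); case: eqVneq => [->|zmn].
  rewrite divff // mulr1n -[d in RHS]card_ord -sumr_const.
  by apply: eq_bigr => j _; rewrite expr1n.
have z1 : z ^+ m / z ^+ n - 1 != 0.
  by rewrite subr_eq0; apply: contraNneq zmn => /divr1_eq ->.
apply: (mulfI z1); rewrite -subrX1 mulr0n mulr0.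
rewrite expr_div_n -!exprM ![(_ * d)%N]mulnC !exprM (prim_expr_order pz).
by rewrite !expr1n divr1 subrr.
Qed.

Lemma ord_addmod_eq (d : nat) (a b c : 'I_d) :
  (ord_addmod a b == ord_addmod a c) = (b == c).
Proof.
by rewrite -!val_eqE /= eqn_modDl !modn_small ?ltn_ord.
Qed.

Lemma mxtens_index_eq (m n : nat) (i j : 'I_m * 'I_n) :
  (mxtens_index i == mxtens_index j) = (i == j).
Proof. exact: (inj_eq (can_inj (@mxtens_indexK m n))). Qed.

Section Entries.
Variable R : realType.
Local Notation C := R[i].

Lemma ketbraE n (u v : 'cV[C]_n) x y : ketbra u v x y = u x 0 * ((v y 0)^*)%R.
Proof. by rewrite mxE big_ord1 !mxE. Qed.

Lemma tens_idE p q r (f : 'M[C]_p -> 'M[C]_q) (rho : 'M[C]_(p * r)) x y k l :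
  tens_id f rho (mxtens_index (x, k)) (mxtens_index (y, l)) =
  f (\matrix_(i < p, j < p)
        rho (mxtens_index (i, k)) (mxtens_index (j, l))) x y.
Proof.
rewrite /tens_id summxE (bigD1 k) //= summxE (bigD1 l) //= tensmxE mxE !eqxx mulr1.
rewrite big1 ?addr0 => [|j /negPf jl]; last by rewrite tensmxE mxE [l == j]eq_sym jl andbF mulr0.
rewrite big1 ?addr0 // => j /negPf jk.
by rewrite summxE big1 // => i _; rewrite tensmxE mxE [k == j]eq_sym jk mulr0.
Qed.

Lemma reassocE p q r (A : 'M[C]_(p * (q * r))) x y k x' y' k' :
  reassoc A (mxtens_index (mxtens_index (x, y), k))
            (mxtens_index (mxtens_index (x', y'), k')) =
  A (mxtens_index (x, mxtens_index (y, k)))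
    (mxtens_index (x', mxtens_index (y', k'))).
Proof.
by rewrite castmxE; congr (A _ _); apply: val_inj; rewrite /= mulnDl -mulnA addnA.
Qed.

Lemma ket2E d (i j a b : 'I_d) :
  ket2 R i j (mxtens_index (a, b)) 0 = ((a, b) == (i, j))%:R.
Proof.
by rewrite !mxE mxtens_indexK /= !ord1 !eqxx !andbT -natrM mulnb.
Qed.

Lemma Phi_ketE d (a b : 'I_d) :
  Phi_ket R d (mxtens_index (a, b)) 0 = (sqrtC d%:R)^-1 *+ (a == b).
Proof.
rewrite mxE summxE (bigD1 a) //= ket2E xpair_eqE eqxx eq_sym big1 => [|i /negPf ia].
  by rewrite addr0 mulr_natr.
by rewrite ket2E xpair_eqE [a == i]eq_sym ia.
Qed.

Lemma PhiE d (a b c e : 'I_d) :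
  Phi R d (mxtens_index (a, b)) (mxtens_index (c, e)) =
  d%:R^-1 *+ ((a == b) && (c == e)).
Proof.
rewrite /Phi ketbraE !Phi_ketE.
case: (a == b); case: (c == e); rewrite ?mulr0n ?mul0r ?rmorph0 ?mulr0 //=.
rewrite geC0_conj ?invr_ge0 ?sqrtC_ge0 ?ler0n // !mulr1n.
by rewrite -invfM -expr2 sqrtCK.
Qed.

Lemma Phi_hatE d (a b c e : 'I_d) :
  Phi_hat R d (mxtens_index (a, b)) (mxtens_index (c, e)) =
  d%:R^-1 *+ [&& a == b, c == e & a == c].
Proof.
rewrite mxE summxE (bigD1 a) //= ketbraE !ket2E !xpair_eqE eqxx big1 => [|i /negPf ia].
  rewrite addr0 rmorph_nat -natrM mulnb mulr_natr; congr (_ *+ nat_of_bool _).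
  rewrite /= [b == a]eq_sym; case: (a == b) => //=.
  by rewrite [c == a]eq_sym; case: eqVneq => [<-|]; rewrite ?andbF ?andbT //= eq_sym.
by rewrite ketbraE ket2E xpair_eqE [a == i]eq_sym ia mul0r.
Qed.

Lemma ZmxE d : Zmx R d = diag_mx (\row_i omega R d ^+ i).
Proof.
apply/matrixP => a b; rewrite summxE (bigD1 a) //= big1 => [|i /negPf ia].
  rewrite mxE ketbraE !mxE !eqxx addr0 mul1r rmorph_nat mulr_natr.
  by rewrite andbT eq_sym.
by rewrite mxE ketbraE !mxE [a == i]eq_sym ia mul0r mulr0.
Qed.

Lemma Zmx_expr d j : Zmx R d ^+ j = diag_mx (\row_i (omega R d ^+ i) ^+ j).
Proof.
elim: j => [|j IH].
  by apply/matrixP => a b; rewrite expr0 !mxE expr0.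
rewrite exprS IH ZmxE -mulmxE mulmx_diag; congr diag_mx.
by apply/rowP => i; rewrite !mxE exprS.
Qed.

Lemma invmx_diag n (v : 'rV[C]_n) : (forall i, v 0 i != 0) ->
  invmx (diag_mx v) = diag_mx (\row_i (v 0 i)^-1).
Proof.
move=> vn0; have vV : diag_mx v *m diag_mx (\row_i (v 0 i)^-1) = 1%:M.
  rewrite mulmx_diag -diag_const_mx; congr diag_mx.
  by apply/rowP => i; rewrite !mxE divff ?vn0.
have [uv _] := mulmx1_unit vV.
by rewrite -[LHS]mulmx1 -vV mulKmx.
Qed.

Lemma tens1_diag m n (v : 'rV[C]_n) :
  tensmx (1%:M : 'M[C]_m) (diag_mx v) =
  diag_mx (\row_k v 0 (mxtens_unindex k).2).
Proof.
apply/matrixP => x y.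
case: (mxtens_indexP x) => a b; case: (mxtens_indexP y) => c e.
rewrite tensmxE !mxE mxtens_index_eq xpair_eqE mxtens_indexK /=.
by case: (a == c); rewrite ?mul1r ?mul0r.
Qed.

Lemma Zmap_KBE d j (A : 'M[C]_(d * d)) (a b c e : 'I_d) :
  Zmap_KB j A (mxtens_index (a, b)) (mxtens_index (c, e)) =
  (omega R d ^+ b / omega R d ^+ e) ^+ j *
    A (mxtens_index (a, b)) (mxtens_index (c, e)).
Proof.
(* The index [a] witnesses 0 < d, as primitivity of [omega] requires. *)
have wn0 : omega R d != 0.
  by rewrite (prim_root_eq0 (omega_prim R _)) -?lt0n (leq_ltn_trans _ (ltn_ord a)).
rewrite /Zmap_KB Zmx_expr invmx_diag => [|i]; last by rewrite mxE !expf_neq0.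
rewrite !tens1_diag mul_mx_diag mul_diag_mx !mxE !mxtens_indexK /= expr_div_n.
by rewrite mulrAC.
Qed.

Lemma CNOT_E d (a b c e : 'I_d) :
  CNOT R d (mxtens_index (a, b)) (mxtens_index (c, e)) =
  ((a == c) && (b == ord_addmod c e))%:R.
Proof.
rewrite summxE (bigD1 c) //= summxE (bigD1 e) //=.
rewrite ketbraE !ket2E eqxx rmorph1 mulr1 xpair_eqE.
rewrite !big1 ?addr0 // => [i /negPf ic|i /negPf ie].
  rewrite summxE big1 // => j _.
  by rewrite ketbraE !ket2E !xpair_eqE [c == i]eq_sym ic rmorph0 mulr0.
by rewrite ketbraE !ket2E !xpair_eqE [e == i]eq_sym ie andbF rmorph0 mulr0.
Qed.

(** The action of V on basis labels. *)
Definition cnot_index d (x : 'I_(d * d * (d * d))) : 'I_(d * d * (d * d)) :=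
  let: (k', k) := mxtens_unindex x in
  let: (a', b') := mxtens_unindex k' in
  let: (a, b) := mxtens_unindex k in
  mxtens_index (mxtens_index (ord_addmod a a', ord_addmod b b'),
                mxtens_index (a, b)).

Lemma VmxE d x y : Vmx R d x y = (x == cnot_index y)%:R.
Proof.
case: (mxtens_indexP x) => k' k; case: (mxtens_indexP y) => l' l.
case: (mxtens_indexP k') => a' b'; case: (mxtens_indexP k) => a b.
case: (mxtens_indexP l') => c' e'; case: (mxtens_indexP l) => c e.
rewrite mxE /pair_keys /cnot_index !mxtens_indexK tensmxE !CNOT_E.
rewrite !mxtens_index_eq !xpair_eqE !mxtens_index_eq !xpair_eqE.
rewrite -natrM mulnb; congr (nat_of_bool _)%:R.
by rewrite andbACA andbC.
Qed.

(** Each column of V is a single basis vector, so one term survives in each of the two matrix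
    products. *)
Lemma conj_relabel n (f : 'I_n -> 'I_n) (V N : 'M[C]_n) :
  (forall x y, V x y = (x == f y)%:R) -> V^t* *m N *m V = mxsub f f N.
Proof.
move=> VE; apply/matrixP => x y; rewrite !mxE (bigD1 (f y)) //= VE eqxx mulr1.
rewrite !mxE (bigD1 (f x)) //= !mxE VE eqxx rmorph1 mul1r.
rewrite !big1 ?addr0 // => z /negPf zf; first by rewrite VE zf mulr0.
by rewrite !mxE VE zf rmorph0 mul0r.
Qed.

Lemma EmapE d (A : 'M[C]_(d * d)) (a' b' a b c' e' c e : 'I_d) :
  Emap A (mxtens_index (mxtens_index (a', b'), mxtens_index (a, b)))
         (mxtens_index (mxtens_index (c', e'), mxtens_index (c, e))) =
  Phi_hat R d (mxtens_index (ord_addmod a a', ord_addmod b b'))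
              (mxtens_index (ord_addmod c c', ord_addmod e e')) *
  A (mxtens_index (a, b)) (mxtens_index (c, e)).
Proof.
rewrite /Emap (conj_relabel _ (@VmxE d)) mxE /cnot_index !mxtens_indexK.
by rewrite tensmxE.
Qed.

Lemma phi_ket_offdiag d j (a b : 'I_d) : a != b ->
  phi_ket R d j (mxtens_index (a, b)) 0 = 0.
Proof.
move=> ab; rewrite /phi_ket Zmx_expr tens1_diag mul_diag_mx mxE Phi_ketE.
by rewrite (negPf ab) mulr0.
Qed.

(** Z is diagonal, so every [phi_ket] stays in the span of the |ii>, and so do the dyads making up
    [rho]. *)
Lemma key_correlated_supp d s (rho : 'M[C]_(d * d * s)) a b c e k l :
    key_correlated rho -> (a != b) || (c != e) ->
  rho (mxtens_index (mxtens_index (a, b), k))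
      (mxtens_index (mxtens_index (c, e), l)) = 0.
Proof.
move=> [P ->] abce; rewrite summxE big1 // => mu _; rewrite summxE big1 // => nu _.
rewrite tensmxE ketbraE.
by case/orP: abce => /phi_ket_offdiag->; rewrite ?rmorph0 ?mulr0 !mul0r.
Qed.

Lemma Emap_correlated d (A : 'M[C]_(d * d)) :
    (forall a b c e, (a != b) || (c != e) ->
       A (mxtens_index (a, b)) (mxtens_index (c, e)) = 0) ->
  Emap A = d%:R^-1 *: \sum_(j < d) tensmx (phi R d j) (Zmap_KB j A).
Proof.
move=> A0; apply/matrixP => x y.
case: (mxtens_indexP x) => k' k; case: (mxtens_indexP y) => l' l.
case: (mxtens_indexP k') => a' b'; case: (mxtens_indexP k) => a b.
case: (mxtens_indexP l') => c' e'; case: (mxtens_indexP l) => c e.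
rewrite EmapE [RHS]mxE summxE.
under eq_bigr => j _ do rewrite tensmxE !Zmap_KBE mulrACA -exprMn.
(* Only the phases depend on j. Off the maximally correlated subspace both sides vanish with A. *)
rewrite -mulr_suml; have [abce|] := boolP ((a != b) || (c != e)).
  by rewrite A0 // !mulr0.
(* With b = a and e = c, the two phases merge into the ratio of omega^(b' + a) and omega^(e' +
   c). *)
rewrite negb_or !negbK => /andP[/eqP <- /eqP <-]; rewrite mulf_div -!exprD !mulrA; congr (_ * _).
rewrite Phi_hatE PhiE !ord_addmod_eq.
have d0 : (0 < d)%N by rewrite (leq_ltn_trans _ (ltn_ord a)).
rewrite (sum_prim_root_ratio _ _ (omega_prim R d0)).
have dn0 : d%:R != 0 :> C by rewrite pnatr_eq0 -lt0n.
have [<-|_] := eqVneq a' b'; last by rewrite !mulr0n !mulr0.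
have [<-|_] := eqVneq c' e'; last by rewrite !mulr0n !mulr0.
(* The character sum contributes d, cancelling one of the two factors 1/d. *)
rewrite /= mulr1n -mulrA mulrnAl mulrnAr divff // mulr1.
by rewrite -val_eqE /= [(a + a')%N]addnC [(c + c')%N]addnC.
Qed.

End Entries.

(* d = |K_A| = |K_B|, sA = |S_A|, sB = |S_B|. *)
Theorem lemma1 (R : realType) (d sA sB : nat)
    (rho : 'M[R[i]]_(d * d * (sA * sB)))
    (rho_state : is_state rho) (rho_kc : key_correlated rho) :
  tens_id (@Emap R d) rho
  = (d%:R)^-1 *: \sum_(j < d)
      reassoc (tensmx (phi R d j) (tens_id (@Zmap_KB R d j) rho)).
Proof.
apply/matrixP => X Y.
case: (mxtens_indexP X) => x k; case: (mxtens_indexP Y) => y l.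
(* Each shield block of [rho] inherits its support, so the identity applies block by block. *)
rewrite tens_idE Emap_correlated => [|a b c e abce]; last first.
  by rewrite mxE key_correlated_supp.
case: (mxtens_indexP x) => x1 x2; case: (mxtens_indexP y) => y1 y2.
rewrite !mxE !summxE; congr (_ * _); apply: eq_bigr => j _.
by rewrite reassocE !tensmxE tens_idE.
Qed.
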